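(* The functors $T_r:\mathbf{Met}\to\mathbf{Met}$ ($r\in[0,\infty]$) together with the maps $(q\le r)_A$, $\eta_A$ and $\mu_{q,r,A}$ of the neighborhood monad form an $\mathcal R$-graded monad on $\mathbf{Met}$, where $\mathcal R=[0,\infty]$ is the pre-ordered monoid of extended non-negative reals with the usual order and addition.
   Context: $\mathbf{Met}$ is the category of extended pseudo-metric spaces (sets $A$ with $d_A:A\times A\to[0,\infty]$ satisfying $d(a,a)=0$, symmetry and the triangle inequality) and non-expansive maps. **Neighborhood monad.** - $T_rM$ has underlying set $\{(x,y)\in M\times M\mid d_M(x,y)\le r\}$ and metric $d_{T_rM}((x,y),(x',y'))=d_M(x,x')$. - For non-expansive $f:A\to B$, $(T_rf)(x,y)=(f(x),f(y))$. - For $q\le r$, $(q\le r)_A:T_qA\to T_rA$ is the identity on pairs (inclusion). - $\eta_A:A\to T_0A$, $\eta_A(x)=(x,x)$. - $\mu_{q,r,A}:T_q(T_rA)\to T_{r+q}A$, $\mu_{q,r,A}((x,y),(x',y'))=(x,y')$. **Graded monad.** An $\mathcal R$-graded monad on a category consists of endofunctors $T_r$ ($r\in\mathcal R$), natural transformations $(q\le r):T_q\to T_r$ for $q\le r$ (functorial in the order), $\eta:\mathrm{Id}\to T_0$, and $\mu_{q,r}:T_qT_r\to T_{q+r}$ (compatible with the maps $(q\le r)$ in both indices), such that for all objects $A$: $\mu_{0,r,A}\circ\eta_{T_rA}=\mathrm{id}_{T_rA}=\mu_{r,0,A}\circ T_r\eta_A$ and $\mu_{p,q+r,A}\circ T_p\mu_{q,r,A}=\mu_{p+q,r,A}\circ\mu_{p,q,T_rA}$.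 *)

(* Defs.v *)
From mathcomp Require Import all_boot all_order all_algebra.
From mathcomp Require Import boolp reals constructive_ereal.

Set Implicit Arguments.
Unset Strict Implicit.
Unset Printing Implicit Defensive.

Import Order.TTheory GRing.Theory Num.Theory.

Local Open Scope ring_scope.
Local Open Scope ereal_scope.

Record category := Category {
  ob :> Type;
  mor : ob -> ob -> Type;
  idm : forall A : ob, mor A A;
  mcomp : forall A B C : ob, mor B C -> mor A B -> mor A C;
  mcomp1m : forall (A B : ob) (f : mor A B), mcomp (idm B) f = f;
  mcompm1 : forall (A B : ob) (f : mor A B), mcomp f (idm A) = f;
  mcompA : forall (A B C D : ob) (h : mor C D) (g : mor B C) (f : mor A B),
    mcomp h (mcomp g f) = mcomp (mcomp h g) f
}.

Arguments mor {c} A B.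
Arguments idm {c} A.
Arguments mcomp {c A B C} g f.

Notation "g \oc f" := (mcomp g f) (at level 50, left associativity).

Definition is_functor (C D : category) (F : C -> D)
    (F1 : forall A B : C, mor A B -> mor (F A) (F B)) : Prop :=
  (forall A : C, F1 A A (idm A) = idm (F A)) /\
  (forall (A B E : C) (g : mor B E) (f : mor A B),
     F1 A E (g \oc f) = F1 B E g \oc F1 A B f).

Definition is_natural (C D : category) (F G : C -> D)
    (F1 : forall A B : C, mor A B -> mor (F A) (F B))
    (G1 : forall A B : C, mor A B -> mor (G A) (G B))
    (alpha : forall A : C, mor (F A) (G A)) : Prop :=
  forall (A B : C) (f : mor A B), alpha B \oc F1 A B f = G1 A B f \oc alpha A.

Record preordered_monoid := PreorderedMonoid {
  grade :> Type;
  g0 : grade;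
  gadd : grade -> grade -> grade;
  gle : grade -> grade -> Prop;
  gadd0l : forall r, gadd g0 r = r;
  gadd0r : forall r, gadd r g0 = r;
  gaddA : forall p q r, gadd p (gadd q r) = gadd (gadd p q) r;
  gle_refl : forall r, gle r r;
  gle_trans : forall p q r, gle p q -> gle q r -> gle p r;
  gle_add : forall q q' r r', gle q q' -> gle r r' -> gle (gadd q r) (gadd q' r')
}.

Arguments g0 {_}.
Arguments gadd {_} q r : rename.
Arguments gle {_} q r : rename.
Arguments gle_add {_ q q1 r r1} qq1 rr1 : rename.

(* The monoid laws of the grades are propositional equalities, so the two sides
   of a graded monad law lie in hom-sets that are equal but not convertible;
   [regrade e] is the identity of T r A = T s A. *)
Definition regrade (C : category) (M : preordered_monoid) (T : M -> C -> C)
    (r s : M) (e : r = s) (A : C) : mor (T r A) (T s A) :=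
  match e in _ = t return mor (T r A) (T t A) with erefl => idm (T r A) end.

Arguments regrade {C M} T {r s} e A.

Section GradedMonad.
Variables (C : category) (M : preordered_monoid).
Variable T : M -> C -> C.
Variable T1 : forall (r : M) (A B : C), mor A B -> mor (T r A) (T r B).
Variable inc : forall (q r : M), gle q r -> forall A : C, mor (T q A) (T r A).
Variable eta : forall A : C, mor A (T g0 A).
Variable mu : forall (q r : M) (A : C), mor (T q (T r A)) (T (gadd q r) A).

Record is_graded_monad : Prop := IsGradedMonad {
  gm_functor : forall r, is_functor (T1 r);
  gm_inc_nat : forall q r (qr : gle q r), is_natural (T1 q) (T1 r) (inc qr);
  gm_inc_refl : forall r (rr : gle r r) A, inc rr A = idm (T r A);
  gm_inc_trans : forall p q r (pq : gle p q) (qr : gle q r) (pr : gle p r) A,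
    inc pr A = inc qr A \oc inc pq A;
  gm_eta_nat : is_natural (fun A B (f : mor A B) => f) (T1 g0) eta;
  gm_mu_nat : forall q r,
    is_natural (fun A B (f : mor A B) => T1 q (T1 r f)) (T1 (gadd q r)) (mu q r);
  gm_mu_inc : forall q q' r r' (qq' : gle q q') (rr' : gle r r') A,
    inc (gle_add qq' rr') A \oc mu q r A =
    mu q' r' A \oc (inc qq' (T r' A) \oc T1 q (inc rr' A));
  gm_unitl : forall r A,
    regrade T (gadd0l r) A \oc (mu g0 r A \oc eta (T r A)) = idm (T r A);
  gm_unitr : forall r A,
    regrade T (gadd0r r) A \oc (mu r g0 A \oc T1 r (eta A)) = idm (T r A);
  gm_assoc : forall p q r A,
    regrade T (gaddA p q r) A \oc (mu p (gadd q r) A \oc T1 p (mu q r A)) =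
    mu (gadd p q) r A \oc mu p q (T r A)
}.

End GradedMonad.

Section ExtendedNonneg.
Variable R : realType.

Definition enn := {r : \bar R | 0 <= r}.

Definition enn0 : enn := exist _ 0 (lexx 0).

Definition enn_add (q r : enn) : enn :=
  exist _ (val q + val r) (adde_ge0 (valP q) (valP r)).

Definition enn_le (q r : enn) : Prop := val q <= val r.

Lemma enn_add0l r : enn_add enn0 r = r.
Proof. by apply: val_inj; rewrite /= add0e. Qed.

Lemma enn_add0r r : enn_add r enn0 = r.
Proof. by apply: val_inj; rewrite /= adde0. Qed.

Lemma enn_addA p q r : enn_add p (enn_add q r) = enn_add (enn_add p q) r.
Proof. by apply: val_inj; rewrite /= addeA. Qed.

Lemma enn_le_refl r : enn_le r r.
Proof. exact: lexx. Qed.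

Lemma enn_le_trans p q r : enn_le p q -> enn_le q r -> enn_le p r.
Proof. exact: le_trans. Qed.

Lemma enn_le_add q q' r r' :
  enn_le q q' -> enn_le r r' -> enn_le (enn_add q r) (enn_add q' r').
Proof. exact: leeD. Qed.

Definition ennM : preordered_monoid :=
  PreorderedMonoid enn_add0l enn_add0r enn_addA
    enn_le_refl enn_le_trans enn_le_add.

End ExtendedNonneg.

Section Met.
Variable R : realType.

Record pmet := PMet {
  pcar :> Type;
  pdist : pcar -> pcar -> \bar R;
  pdist_ge0 : forall x y, 0 <= pdist x y;
  pdist_xx : forall x, pdist x x = 0;
  pdist_sym : forall x y, pdist x y = pdist y x;
  pdist_tri : forall x y z, pdist x z <= pdist x y + pdist y z
}.

Record nonexp (A B : pmet) := Nonexp {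
  nfun :> A -> B;
  nfunP : forall x y, pdist (nfun x) (nfun y) <= pdist x y
}.

Lemma nonexp_eq (A B : pmet) (f g : nonexp A B) : f =1 g -> f = g.
Proof.
case: f g => [f fP] [g gP] /= /funext fg; rewrite fg in fP *.
by congr Nonexp; apply: Prop_irrelevance.
Qed.

Definition nonexp_id (A : pmet) : nonexp A A :=
  @Nonexp A A (fun x => x) (fun x y => lexx _).

Definition nonexp_comp (A B C : pmet) (g : nonexp B C) (f : nonexp A B) :
    nonexp A C :=
  @Nonexp A C (fun x => g (f x))
    (fun x y => le_trans (nfunP g (f x) (f y)) (nfunP f x y)).

Lemma nonexp_comp1m A B (f : nonexp A B) : nonexp_comp (nonexp_id B) f = f.
Proof. exact: nonexp_eq. Qed.

Lemma nonexp_compm1 A B (f : nonexp A B) : nonexp_comp f (nonexp_id A) = f.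
Proof. exact: nonexp_eq. Qed.

Lemma nonexp_compA A B C D (h : nonexp C D) (g : nonexp B C) (f : nonexp A B) :
  nonexp_comp h (nonexp_comp g f) = nonexp_comp (nonexp_comp h g) f.
Proof. exact: nonexp_eq. Qed.

Definition Met : category :=
  Category nonexp_comp1m nonexp_compm1 nonexp_compA.

End Met.

Section Neighborhood.
Variable R : realType.

Definition nbhd_car (r : ennM R) (A : Met R) : Type :=
  {p : A * A | pdist p.1 p.2 <= val r}.

Definition nbhd (r : ennM R) (A : Met R) : Met R :=
  @PMet R (nbhd_car r A) (fun u v => pdist (val u).1 (val v).1)
    (fun u v => pdist_ge0 _ _) (fun u => pdist_xx _)
    (fun u v => pdist_sym _ _) (fun u v w => pdist_tri _ _ _).

Lemma nbhd_map_subproof (r : ennM R) (A B : Met R) (f : mor A B)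
    (u : nbhd r A) : pdist (f (val u).1) (f (val u).2) <= val r.
Proof. exact: le_trans (nfunP f _ _) (valP u). Qed.

Definition nbhd_map (r : ennM R) (A B : Met R) (f : mor A B) :
    mor (nbhd r A) (nbhd r B) :=
  @Nonexp R (nbhd r A) (nbhd r B)
    (fun u => exist _ (f (val u).1, f (val u).2) (nbhd_map_subproof f u))
    (fun u v => nfunP f _ _).

Definition nbhd_inc (q r : ennM R) (qr : gle q r) (A : Met R) :
    mor (nbhd q A) (nbhd r A) :=
  @Nonexp R (nbhd q A) (nbhd r A)
    (fun u => exist _ (val u) (le_trans (valP u) qr))
    (fun u v => lexx _).

Lemma nbhd_eta_subproof (A : Met R) (x : A) :
  pdist x x <= val (g0 : ennM R).
Proof. by rewrite pdist_xx. Qed.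

Definition nbhd_eta (A : Met R) : mor A (nbhd g0 A) :=
  @Nonexp R A (nbhd g0 A)
    (fun x => exist _ (x, x) (nbhd_eta_subproof x))
    (fun x y => lexx _).

Lemma nbhd_mu_subproof (q r : ennM R) (A : Met R) (u : nbhd q (nbhd r A)) :
  pdist (val (val u).1).1 (val (val u).2).2 <= val (gadd q r).
Proof. exact: le_trans (pdist_tri _ _ _) (leeD (valP u) (valP (val u).2)). Qed.

Definition nbhd_mu (q r : ennM R) (A : Met R) :
    mor (nbhd q (nbhd r A)) (nbhd (gadd q r) A) :=
  @Nonexp R (nbhd q (nbhd r A)) (nbhd (gadd q r) A)
    (fun u => exist _ ((val (val u).1).1, (val (val u).2).2)
                (nbhd_mu_subproof u))
    (fun u v => lexx _).

End Neighborhood.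

(* Main.v *)
Require Import Defs.
From mathcomp Require Import all_boot reals.

(** A point of [nbhd r A] is a pair of points of [A] with a proof-irrelevant distance bound, and
    grades affect only the bound. So every law reduces to an equation between pairs. Since [nbhd_mu]
    keeps the outermost first and second points, it is associative and unital. *)

Lemma nbhd_mor_eq (R : realType) (r : ennM R) (A B : Met R)
    (f g : mor A (nbhd r B)) :
  (forall x, val (nfun f x) = val (nfun g x)) -> f = g.
Proof. by move=> fg; apply: nonexp_eq => x; apply: val_inj; exact: fg. Qed.

(** Removes the transport from the unit and associativity laws, whose grade equations are only
    propositional. *)
Lemma val_regrade_nbhd (R : realType) (r s : ennM R) (e : r = s) (A : Met R)
    (u : nbhd r A) :
  val (nfun (regrade (@nbhd R) e A) u) = val u.
Proof. by case: s / e. Qed.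

Theorem lemma4p5 (R : realType) :
  @is_graded_monad (Met R) (ennM R)
    (@nbhd R) (@nbhd_map R) (@nbhd_inc R) (@nbhd_eta R) (@nbhd_mu R).
Proof.
split.
- move=> r; split=> [A|A B E g f]; apply: nbhd_mor_eq => //.
  (* [(p.1, p.2)] reduces to [p] only once [p] is destructed. *)
  by case=> [[x y] ?].
- by move=> q r qr A B f; apply: nbhd_mor_eq.
- by move=> r rr A; apply: nbhd_mor_eq.
- by move=> p q r pq qr pr A; apply: nbhd_mor_eq.
- by move=> A B f; apply: nbhd_mor_eq.
- by move=> q r A B f; apply: nbhd_mor_eq.
- by move=> q q' r r' qq' rr' A; apply: nbhd_mor_eq.
- move=> r A; apply: nbhd_mor_eq => u.
  (* The inner point is [((x, y), (x, y))]. *)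
  by rewrite [LHS]val_regrade_nbhd; case: u => [[x y] ?].
- move=> r A; apply: nbhd_mor_eq => u.
  (* Here it is [((x, x), (y, y))]. *)
  by rewrite [LHS]val_regrade_nbhd; case: u => [[x y] ?].
- by move=> p q r A; apply: nbhd_mor_eq => u; rewrite [LHS]val_regrade_nbhd.
Qed.
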